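(* For any subspaces $U,V,W\subset X$ (of possibly distinct dimensions), $\Theta_{U,W}\le\Theta_{U,V}+\Theta_{V,W}$.
   Context: $X$ is an $n$-dimensional vector space over $\mathbb{R}$ (real case) or $\mathbb{C}$ (complex case) with an inner product $\langle\cdot,\cdot\rangle$ (Hermitian in the complex case, conjugate-linear in the left entry). Subspaces and dimensions are over the same field. Principal angles: for nonzero subspaces $V,W\subset X$, with $p=\dim V$, $q=\dim W$, $m=\min\{p,q\}$, there are orthonormal bases $(e_1,\dots,e_p)$ of $V$ and $(f_1,\dots,f_q)$ of $W$ and uniquely determined numbers $0\le\theta_1\le\dots\le\theta_m\le\frac{\pi}{2}$ (the principal angles) such that $\langle e_i,f_j\rangle=\delta_{ij}\cos\theta_i$ (equal to $0$ whenever $i\neq j$). Grassmann angle: for nonzero subspaces $V,W\subset X$ with principal angles $\theta_1,\dots,\theta_m$, the Grassmann angle $\Theta_{V,W}\in[0,\frac{\pi}{2}]$ of $V$ with $W$ is $\Theta_{V,W}=\arccos(\cos\theta_1\cdots\cos\theta_m)$ if $\dim V\le\dim W$, and $\Theta_{V,W}=\frac{\pi}{2}$ if $\dim V>\dim W$. Also $\Theta_{\{0\},\{0\}}=\Theta_{\{0\},V}=0$ and $\Theta_{V,\{0\}}=\frac{\pi}{2}$ for $V\ne\{0\}$. *)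

(* Defs.v *)
(* MathComp-Analysis over an arbitrary [R : realType]; complex scalars are
   [R[i]] from mathcomp-real-closed. *)
From HB Require Import structures.
From mathcomp Require Import all_boot all_order all_algebra.
From mathcomp Require Export complex.
From mathcomp Require Import classical_sets.
From mathcomp Require Export reals trigo.

Set Implicit Arguments.
Unset Strict Implicit.
Unset Printing Implicit Defensive.

Import Order.TTheory GRing.Theory Num.Theory.
Local Open Scope ring_scope.

(* The real and complex cases share the definitions below: [K] is the scalar
   field, [iota] embeds the reals into it, and [conj] is the conjugation of [K]
   ([idfun] both times when [K] is [R]). *)
Section GrassmannAngle.
Variables (R : realType) (K : numFieldType).
Variables (iota : R -> K) (conj : {rmorphism K -> K}).
Variables (X : vectType K) (form : {dot X for conj}).

(* A form of type [{dot X for conj}] is conjugate-linear in its right entry,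
   while the inner product here is conjugate-linear in the left one. *)
Definition inner (u v : X) : K := form v u.

Definition is_principal_angles (V W : {vspace X})
    (t : (minn (\dim V) (\dim W)).-tuple R) : Prop :=
  exists (e : (\dim V).-tuple X) (f : (\dim W).-tuple X),
    [/\ basis_of V e && orthonormal form e,
        basis_of W f && orthonormal form f,
        sorted <=%R t,
        {in t, forall x, 0 <= x <= pi / 2} &
        forall (i : 'I_(\dim V)) (j : 'I_(\dim W)),
          inner (tnth e i) (tnth f j) =
            (if i == j :> nat then iota (cos t`_i) else 0)].

(* The principal angles exist and are unique, so that the default value of
   [xget] is never returned when [V] and [W] are nonzero. *)
Definition principal_angles (V W : {vspace X}) :
    (minn (\dim V) (\dim W)).-tuple R :=
  xget [tuple 0 | _ < _] (@is_principal_angles V W).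

Definition grassmann_angle (V W : {vspace X}) : R :=
  if V == 0%VS then 0
  else if W == 0%VS then pi / 2
  else if (\dim V <= \dim W)%N
       then acos (\prod_(x <- principal_angles V W) cos x)
       else pi / 2.

End GrassmannAngle.

Definition real_grassmann_angle (R : realType) (X : vectType R)
    (form : {dot X for idfun}) (V W : {vspace X}) : R :=
  grassmann_angle (fun x : R => x) form V W.

Definition complex_grassmann_angle (R : realType) (X : vectType R[i])
    (form : {dot X for Num.conj}) (V W : {vspace X}) : R :=
  grassmann_angle (fun x : R => x%:C%C) form V W.

(* Main.v *)
Require Import Defs.
From HB Require Import structures.
From mathcomp Require Import all_boot all_order all_algebra.
From mathcomp Require Import complex reals.
From mathcomp Require Import all_fingroup trigo ring lra.

(** The Grassmann angle of [V] with [W] is the angle between the blade of [V],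
    i.e. the exterior product of a basis, and its orthogonal projection on the
    exterior power of [W]; the triangle inequality is then that of angles
    between lines in an inner product space, here an exterior power of [X].
    Exterior powers enter only through Gram determinants: for matrices [Y] and
    [Z] whose rows are coordinates of [p]-tuples of vectors in an orthonormal
    basis, [\det (Y *m Z^H)] is the inner product of the two blades
    ([det_gram_sum], a form of the Cauchy--Binet formula), hence it obeys the
    Cauchy--Schwarz inequality, also for linear combinations of blades
    ([cauchy_schwarz_blades]).

    If [A] is the matrix of inner products of orthonormal bases of [V] and [W]
    and [\dim V <= \dim W], then [cos^2] of the angle of [V] with [W] is
    [\det (A *m A^H)], for any choice of the bases ([grassmann_angle_gram],
    [det_gram_basis]). This requires principal angles to exist
    ([exists_principal_angles]): a basis of [V] that diagonalizes the form
    [<P u, P v>], with [P] the projection on [W], is built one critical vector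
    at a time ([exists_critical]), and its normalized projections are completed
    to a basis of [W]. The scalar field matters only for the existence of an
    eigenvalue of a Hermitian matrix, which in the real case is obtained by
    passing to the complex numbers.

    For the inequality only [\dim U <= \dim V <= \dim W] is of interest, the
    right-hand side being at least [pi / 2] otherwise. Let [a] be the unit blade
    of [U], [b] its projection on (the exterior power of) [V], and [c] the
    projection of [b] on [W]. The angle between [a] and [b] is that of [U] with
    [V]; the angle between [a] and [c] is at least that of [U] with [W], as [c]
    lies in the exterior power of [W]; the angle between [b] and [c] is at most
    that of [V] with [W]: in principal bases of [V] and [W], the squared length
    of the projection of a unit [p]-blade of [V] is a weighted mean of products
    of [p] squared cosines, each at least the product of all the squared cosines
    ([det_gram_diag_ge]). So the spherical triangle inequality for [a], [b], [c]
    concludes. *)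

Set Implicit Arguments.
Unset Strict Implicit.
Unset Printing Implicit Defensive.
Import Order.TTheory GRing.Theory Num.Theory.
Local Open Scope ring_scope.

(** * Cauchy--Binet *)

Section CauchyBinet.
Variables (K : comNzRingType) (p n : nat).
Implicit Types X Y : 'M[K]_(p, n).

Lemma det_mulmx_tr_colsub X Y :
  \det (X *m Y^T) =
  \sum_(f : {ffun 'I_p -> 'I_n}) (\prod_i X i (f i)) * \det (colsub f Y).
Proof.
under [RHS]eq_bigr => f _ do rewrite -det_tr /determinant mulr_sumr.
rewrite exchange_big /=; apply: eq_bigr => s _.
under eq_bigr => i _ do rewrite mxE.
rewrite bigA_distr_bigA /= mulr_sumr; apply: eq_bigr => f _.
rewrite big_split /= mulrCA; congr (_ * (_ * _)).
by apply: eq_bigr => i _; rewrite !mxE.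
Qed.

(** Cauchy--Binet with the sum over all column selections instead of the
    increasing ones: each [p]-subset of columns is then counted [p!] times and
    the selections that repeat a column contribute zero. It follows by averaging
    the expansion [det_mulmx_tr_colsub] over the reorderings of [f]. *)
Lemma cauchy_binet X Y :
  (p`!)%:R * \det (X *m Y^T) =
  \sum_(f : {ffun 'I_p -> 'I_n}) \det (colsub f X) * \det (colsub f Y).
Proof.
transitivity (\sum_(s : 'S_p) \det (X *m Y^T)).
  by rewrite sumr_const card_Sn mulr_natl.
transitivity (\sum_(f : {ffun 'I_p -> 'I_n}) \sum_(s : 'S_p)
    (-1) ^+ s * (\prod_i colsub f X i (s i)) * \det (colsub f Y)); last first.
  by apply: eq_bigr => f _; rewrite -mulr_suml.
rewrite [RHS]exchange_big /=; apply: eq_bigr => s _.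
rewrite det_mulmx_tr_colsub.
have bij_s : bijective (fun f : {ffun 'I_p -> 'I_n} => [ffun i => f (s i)]).
  exists (fun f : {ffun 'I_p -> 'I_n} => [ffun i => f (s^-1%g i)]) => f;
  by apply/ffunP => i; rewrite !ffunE ?permK ?permKV.
rewrite (reindex _ (onW_bij _ bij_s)) /=; apply: eq_bigr => f _.
have -> : colsub [ffun i => f (s i)] Y = col_perm s (colsub f Y).
  by apply/matrixP => i j; rewrite !mxE ffunE.
rewrite col_permE det_mulmx det_perm odd_permV.
rewrite mulrA mulrAC [_ * (-1) ^+ _]mulrC; congr (_ * _ * _).
by apply: eq_bigr => i _; rewrite ffunE !mxE.
Qed.

End CauchyBinet.

(** * Gram determinants as inner products of blades *)

Section Blades.
Variables (K : numFieldType) (conj : {rmorphism K -> K}).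
Hypothesis mul_conj : forall x, x * conj x = `|x| ^+ 2.

Lemma norm_conj x : `|conj x| = `|x|.
Proof.
have [->|x0] := eqVneq x 0; first by rewrite rmorph0.
apply: (mulfI (x := `|x|)); first by rewrite normr_eq0.
by rewrite -normrM mul_conj normrX normr_id expr2.
Qed.

Lemma conjK : involutive conj.
Proof.
move=> x; have [->|x0] := eqVneq x 0; first by rewrite !rmorph0.
apply: (mulfI (x := conj x)); first by rewrite fmorph_eq0.
by rewrite mul_conj norm_conj -mul_conj mulrC.
Qed.

Lemma conj_ge0_id x : 0 <= x -> conj x = x.
Proof.
move=> x0; have [->|xn0] := eqVneq x 0; first by rewrite rmorph0.
by apply: (mulfI xn0); rewrite mul_conj ger0_norm ?expr2.
Qed.

Lemma cauchy_schwarz_sum (I : finType) (a b : I -> K) :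
  `|\sum_i a i * conj (b i)| ^+ 2
    <= (\sum_i a i * conj (a i)) * (\sum_i b i * conj (b i)).
Proof.
set A := \sum_i a i * conj (a i); set B := \sum_i b i * conj (b i).
set s := \sum_i _.
have B_ge0 : 0 <= B.
  by apply: sumr_ge0 => i _; rewrite mul_conj exprn_ge0.
have [B0|Bn0] := eqVneq B 0.
  suff -> : s = 0 by rewrite normr0 expr0n B0 mulr0.
  apply: big1 => i _; apply/eqP; rewrite mulf_eq0 fmorph_eq0; apply/orP; right.
  have /allP/(_ i (mem_index_enum i)) :
      all (fun i => b i * conj (b i) == 0) (index_enum I).
    move/eqP: B0; rewrite psumr_eq0 // => j _.
    by rewrite mul_conj exprn_ge0.
  by rewrite mul_conj expf_eq0 normr_eq0.
have B_gt0 : 0 < B by rewrite lt_neqAle eq_sym Bn0.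
have conj_s : \sum_i b i * conj (a i) = conj s.
  by rewrite rmorph_sum; apply: eq_bigr => i _; rewrite rmorphM /= conjK mulrC.
have : 0 <= \sum_i (B * a i - s * b i) * conj (B * a i - s * b i).
  by apply: sumr_ge0 => i _; rewrite mul_conj exprn_ge0.
rewrite (eq_bigr (fun i => B ^+ 2 * (a i * conj (a i))
    - B * conj s * (a i * conj (b i)) - s * B * (b i * conj (a i))
    + s * conj s * (b i * conj (b i)))); last first.
  by move=> i _; rewrite rmorphB !rmorphM /= (conj_ge0_id B_ge0); ring.
rewrite big_split /= !sumrB -!mulr_sumr conj_s -/A -/B -/s.
rewrite -mul_conj.
have -> : B ^+ 2 * A - B * conj s * s - s * B * conj s + s * conj s * B
   = B * (A * B - s * conj s).
  ring.
by rewrite pmulr_rge0 // subr_ge0.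
Qed.

Local Notation "A ^H" := (map_mx conj A^T) (at level 2, format "A ^H").

(** The minors [\det (colsub f X)] are the coordinates of the exterior product
    of the rows of [X], so that [\det (X *m Y^H)] is an inner product of blades
    up to the factor [p!]. *)
Lemma det_gram_sum p n (X Y : 'M[K]_(p, n)) :
  (p`!)%:R * \det (X *m Y^H) =
  \sum_(f : {ffun 'I_p -> 'I_n}) \det (colsub f X) * conj (\det (colsub f Y)).
Proof.
rewrite -map_trmx cauchy_binet; apply: eq_bigr => f _; rewrite -det_map_mx.
by congr (_ * \det _); apply/matrixP => i j; rewrite !mxE.
Qed.

Lemma det_gram_ge0 p n (X : 'M[K]_(p, n)) : 0 <= \det (X *m X^H).
Proof.
have fact_gt0K : (0 : K) < (p`!)%:R by rewrite ltr0n fact_gt0.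
rewrite -(pmulr_rge0 _ fact_gt0K) det_gram_sum.
by apply: sumr_ge0 => f _; rewrite mul_conj exprn_ge0.
Qed.

(** Cauchy--Schwarz for the combinations [X - s Y] and [Z - t Y] of the blades of
    [X], [Y] and [Z]; these combinations are in general not blades, which is why
    the inequality is derived from the coordinates of [det_gram_sum]. *)
Lemma cauchy_schwarz_blades p n (X Y Z : 'M[K]_(p, n)) s t :
    0 <= s -> 0 <= t ->
  `|\det (X *m Z^H) - t * \det (X *m Y^H) - s * \det (Y *m Z^H)
       + s * t * \det (Y *m Y^H)| ^+ 2
  <= (\det (X *m X^H) - s * \det (X *m Y^H) - s * \det (Y *m X^H)
       + s ^+ 2 * \det (Y *m Y^H))
   * (\det (Z *m Z^H) - t * \det (Z *m Y^H) - t * \det (Y *m Z^H)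
       + t ^+ 2 * \det (Y *m Y^H)).
Proof.
move=> s_ge0 t_ge0.
have fact_gt0K : (0 : K) < (p`!)%:R by rewrite ltr0n fact_gt0.
pose m (V : 'M[K]_(p, n)) (f : {ffun 'I_p -> 'I_n}) := \det (colsub f V).
have expand (V W V' W' : 'M[K]_(p, n)) u v : 0 <= v ->
    \sum_f (m V f - u * m V' f) * conj (m W f - v * m W' f) =
    (p`!)%:R * (\det (V *m W^H) - v * \det (V *m W'^H)
      - u * \det (V' *m W^H) + u * v * \det (V' *m W'^H)).
  move=> v_ge0.
  rewrite (eq_bigr (fun f => m V f * conj (m W f) - v * (m V f * conj (m W' f))
     - u * (m V' f * conj (m W f)) + u * v * (m V' f * conj (m W' f)))).
    rewrite big_split /= !sumrB -!mulr_sumr -!det_gram_sum; ring.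
  by move=> f _; rewrite rmorphB !rmorphM /= (conj_ge0_id v_ge0); ring.
have := cauchy_schwarz_sum (fun f => m X f - s * m Y f)
  (fun f => m Z f - t * m Y f).
rewrite !expand // -!expr2 => bound.
rewrite -(ler_pM2l (exprn_gt0 2 fact_gt0K)) 
  -[in leLHS](ger0_norm (ltW fact_gt0K)).
by rewrite -exprMn -normrM [_ ^+ 2 * _]mulrACA.
Qed.

Lemma cauchy_schwarz_det p n (X Z : 'M[K]_(p, n)) :
  `|\det (X *m Z^H)| ^+ 2 <= \det (X *m X^H) * \det (Z *m Z^H).
Proof.
have := cauchy_schwarz_blades X 0 Z (lexx 0) (lexx 0).
by rewrite expr0n /= !mul0r !subr0 !addr0.
Qed.

(** In the expansion of the right-hand side over column selections, the squared
    minor of [f] has weight [\prod_i d (f i)]. The minor vanishes unless [f] is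
    injective, and then the weight is a subproduct of [\prod_j d j], whose
    missing factors are at most [1]. *)
Lemma det_gram_diag_ge p q (A : 'M[K]_(p, q)) (d : 'rV[K]_q) :
    (forall j, 0 <= d 0 j <= 1) ->
  \det (A *m A^H) * \prod_j d 0 j <= \det (A *m diag_mx d *m A^H).
Proof.
move=> d01.
have fact_gt0K : (0 : K) < (p`!)%:R by rewrite ltr0n fact_gt0.
rewrite -(ler_pM2l fact_gt0K) mulrA !det_gram_sum mulr_suml.
apply: ler_sum => f _.
have -> : colsub f (A *m diag_mx d) = colsub f A *m diag_mx (\row_i d 0 (f i)).
  by rewrite !mul_mx_diag; apply/matrixP => i j; rewrite !mxE.
rewrite det_mulmx det_diag [in leRHS]mulrAC !mul_conj.
have [/injectiveP f_inj|/injectivePn[i [j neq_ij eq_f]]] := boolP (injectiveb f).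
  apply: ler_wpM2l; first exact: exprn_ge0.
  rewrite (eq_bigr (fun i => d 0 (f i))); last by move=> i _; rewrite mxE.
  rewrite (bigID (mem (f @: setT))) /= big_imset /=; last first.
    by move=> x y _ _ /f_inj.
  rewrite (eq_bigl xpredT) => [|i]; last by rewrite inE.
  rewrite ler_piMr //; last by apply: prodr_ile1 => i _.
  by apply: prodr_ge0 => i _; have /andP[] := d01 (f i).
rewrite -det_tr (determinant_alternate neq_ij) ?normr0 ?expr0n ?mul0r //.
by move=> k; rewrite !mxE eq_f.
Qed.

(** The rows of [E], [F] and [G] span the three subspaces. The blade of [E]
    projects on the second one as the blade of [Y := A *m F], which in turn
    projects on the third one as the blade of [Z := A *m B *m G]; [w] is the
    squared length of [Z] and [k] its inner product with [E]. The last bound is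
    Cauchy--Schwarz for the components of [E] and [Z] orthogonal to [Y], that is
    for [E - Y] and [Z - (w / |Y|^2) Y]. *)
Lemma blade_triangle p q r n (E : 'M[K]_(p, n)) (F : 'M[K]_(q, n))
    (G : 'M[K]_(r, n)) (d : 'rV[K]_q) :
    let A := E *m F^H in let B := F *m G^H in let C := E *m G^H in
    E *m E^H = 1%:M -> F *m F^H = 1%:M -> G *m G^H = 1%:M ->
    B *m B^H = diag_mx d -> (forall j, 0 <= d 0 j <= 1) ->
    0 < \det (A *m A^H) ->
  exists w : K, [/\ \det (A *m A^H) * \det (B *m B^H) <= w <= \det (A *m A^H) &
    exists k : K, `|k| ^+ 2 <= \det (C *m C^H) * w /\
      `|k - w| ^+ 2 <= (1 - \det (A *m A^H)) * (w - w ^+ 2 / \det (A *m A^H))].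
Proof.
move=> A B C EE FF GG BB d01; set x2 := \det (A *m A^H) => x2_gt0.
have adjM a b c (V : 'M[K]_(a, b)) (W : 'M[K]_(b, c)) : (V *m W)^H = W^H *m V^H.
  by rewrite trmx_mul map_mxM.
have adjK a b (V : 'M[K]_(a, b)) : (V^H)^H = V.
  by apply/matrixP => i j; rewrite !mxE conjK.
pose Y := A *m F; pose Z := A *m B *m G.
have EY : E *m Y^H = A *m A^H by rewrite [Y^H]adjM mulmxA.
have YE : Y *m E^H = A *m A^H by rewrite [A^H]adjM adjK -!mulmxA.
have YY : Y *m Y^H = A *m A^H by rewrite [Y^H]adjM mulmxA -(mulmxA A) FF mulmx1.
have EZ : E *m Z^H = C *m (A *m B)^H by rewrite [Z^H]adjM mulmxA.
have ZZ : Z *m Z^H = A *m B *m (A *m B)^H.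
  by rewrite [Z^H]adjM mulmxA -(mulmxA (A *m B)) GG mulmx1.
have YZ : Y *m Z^H = A *m B *m (A *m B)^H.
  by rewrite [Z^H]adjM mulmxA -(mulmxA A F).
have ZY : Z *m Y^H = A *m B *m (A *m B)^H.
  by rewrite [(A *m B)^H]adjM [B^H]adjM [Y^H]adjM adjK /Z /B !mulmxA.
pose w := \det (A *m B *m (A *m B)^H).
have w_ge0 : 0 <= w by exact: det_gram_ge0.
exists w; split; first (apply/andP; split).
- rewrite /w [(A *m B)^H]adjM mulmxA -(mulmxA A) BB det_diag.
  exact: det_gram_diag_ge.
- have := cauchy_schwarz_det Y Z.
  rewrite YY ZZ YZ -/w -/x2 ger0_norm // expr2.
  have [->|w_neq0] := eqVneq w 0; first by move=> _; exact: ltW.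
  by rewrite ler_pM2r // lt_neqAle eq_sym w_neq0.
exists (\det (C *m (A *m B)^H)); split; first exact: cauchy_schwarz_det.
have t_ge0 : 0 <= w / x2 by rewrite divr_ge0 // ltW.
have := cauchy_schwarz_blades E Y Z ler01 t_ge0.
rewrite EE EZ EY YE YY ZZ ZY YZ det1 -/w -/x2 => bound.
have x2_neq0 : x2 != 0 by rewrite gt_eqF.
have -> : \det (C *m (A *m B)^H) - w = \det (C *m (A *m B)^H)
    - w / x2 * x2 - 1 * w + 1 * (w / x2) * x2 by field.
apply: le_trans bound _; rewrite le_eqVlt; apply/orP; left; apply/eqP.
by field.
Qed.

End Blades.

(** * Cosines of angles *)

Section Trigo.
Variable R : realType.
Implicit Types x y z : R.

Lemma le_of_sqr x y : 0 <= y -> x ^+ 2 <= y ^+ 2 -> x <= y.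
Proof.
move=> y_ge0 xy; apply: le_trans (ler_norm x) _; rewrite -(ger0_norm y_ge0).
by rewrite -ler_sqr ?nnegrE // !real_normK ?num_real.
Qed.

(** With [x] the cosine of the first angle, write [w = (x v)^2], so that [v] is
    the cosine of the angle between the two projections of [blade_triangle] and
    [v >= y]. Dividing [w <= k + m] by [x v] gives the claim for [v] in place of
    [y], and [x v - sqrt (1 - x^2) sqrt (1 - v^2)] increases with [v]. *)
Lemma cos_triangle_of_square x y z w k m :
    0 < x -> 0 <= y -> 0 <= z -> 0 <= m ->
    (x * y) ^+ 2 <= w <= x ^+ 2 -> k ^+ 2 <= z ^+ 2 * w -> w <= k + m ->
    m ^+ 2 <= (1 - x ^+ 2) * (w - w ^+ 2 / x ^+ 2) ->
  x * y <= z + Num.sqrt (1 - x ^+ 2) * Num.sqrt (1 - y ^+ 2).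
Proof.
move=> x_gt0 y_ge0 z_ge0 m_ge0 /andP[w_ge w_le] k_le w_km m_le.
have [->|y_neq0] := eqVneq y 0.
  by rewrite mulr0 addr_ge0 // mulr_ge0 // sqrtr_ge0.
have y_gt0 : 0 < y by rewrite lt_neqAle eq_sym y_neq0.
have w_gt0 : 0 < w by apply: lt_le_trans w_ge; rewrite exprn_gt0 // mulr_gt0.
pose v := Num.sqrt w / x.
have v_gt0 : 0 < v by rewrite divr_gt0 // sqrtr_gt0.
have w_eq : w = (x * v) ^+ 2.
  by rewrite /v mulrC divfK ?gt_eqF // sqr_sqrtr // ltW.
have xv_gt0 : 0 < x * v by rewrite mulr_gt0.
have yv : y <= v.
  rewrite -(ler_pM2l x_gt0); apply: le_of_sqr; first exact: ltW.
  by rewrite -w_eq.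
have v1 : v ^+ 2 <= 1.
  by move: w_le; rewrite w_eq exprMn ger_pMr // exprn_gt0.
have k_bound : k <= z * (x * v).
  apply: le_of_sqr; first by rewrite mulr_ge0 // ltW.
  by rewrite exprMn -w_eq.
have m_bound : m <= x * v * (Num.sqrt (1 - x ^+ 2) * Num.sqrt (1 - v ^+ 2)).
  have eq_m : (1 - x ^+ 2) * (w - w ^+ 2 / x ^+ 2) =
      (x * v) ^+ 2 * ((1 - x ^+ 2) * (1 - v ^+ 2)).
    by rewrite w_eq; field; rewrite gt_eqF.
  have [x1|x1] := leP (x ^+ 2) 1.
    apply: le_of_sqr.
      by rewrite (mulr_ge0 (ltW xv_gt0)) // mulr_ge0 ?sqrtr_ge0.
    rewrite exprMn [in leRHS](exprMn 2 (Num.sqrt _)).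
    by rewrite !sqr_sqrtr ?subr_ge0 // -eq_m.
  (* For [x > 1] the first square root is [0] by convention, and [m = 0]. *)
  have m0 : m ^+ 2 <= 0.
    apply: le_trans m_le _; rewrite eq_m mulr_ge0_le0 ?sqr_ge0 //.
    by rewrite mulr_le0_ge0 // ?subr_ge0 // subr_le0 ltW.
  have /eqP : m ^+ 2 = 0 by apply/eqP; rewrite eq_le m0 sqr_ge0.
  rewrite expf_eq0 /= => /eqP ->.
  by rewrite (mulr_ge0 (ltW xv_gt0)) // mulr_ge0 ?sqrtr_ge0.
have : x * v <= z + Num.sqrt (1 - x ^+ 2) * Num.sqrt (1 - v ^+ 2).
  rewrite -(ler_pM2l xv_gt0) -expr2 -w_eq.
  apply: le_trans w_km _; rewrite mulrDr [x * v * z]mulrC.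
  exact: lerD.
move=> bound; apply: (le_trans (y := x * v)); first by rewrite ler_pM2l.
apply: le_trans bound _; rewrite lerD2l ler_wpM2l ?sqrtr_ge0 // ler_wsqrtr //.
by rewrite lerD2l lerN2 ler_sqr // nnegrE ltW.
Qed.

Lemma acos_itv01 x : 0 <= x <= 1 -> 0 <= acos x <= pi / 2.
Proof.
move=> /andP[x0 x1].
have x_itv : -1 <= x <= 1 by rewrite x1 andbT (le_trans _ x0) // lerN10.
rewrite acos_ge0 //= leNgt; apply/negP => acos_gt.
have : cos (acos x) < 0.
  rewrite -cos_pihalf ltr_cos ?in_itv //=; last by rewrite acos_ge0 ?acos_lepi.
  by have := pi_gt0 R; lra.
by rewrite acosK ?in_itv //= ltNge x0.
Qed.

(** The hypothesis says that [cos (acos x + acos y) <= z]. *)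
Lemma acos_triangle x y z :
    0 <= x <= 1 -> 0 <= y <= 1 -> 0 <= z <= 1 ->
    x * y <= z + Num.sqrt (1 - x ^+ 2) * Num.sqrt (1 - y ^+ 2) ->
  acos z <= acos x + acos y.
Proof.
move=> x01 y01 z01 xy_le.
have itv u : 0 <= u <= 1 -> -1 <= u <= 1.
  by move=> /andP[u0 ->]; rewrite andbT (le_trans _ u0) // lerN10.
have [/andP[x0 xp] /andP[y0 yp]] := (acos_itv01 x01, acos_itv01 y01).
rewrite leNgt; apply/negP => lt_z; move: (lt_z).
have /andP[z0 zp] := acos_itv01 z01.
rewrite -ltr_cos; last 2 first.
- by rewrite in_itv /= addr_ge0 //=; lra.
- by rewrite in_itv /= z0 acos_lepi ?itv.
rewrite cosD !acosK ?in_itv /= ?itv // !sin_acos ?itv // ltNge.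
by rewrite lerBlDr xy_le.
Qed.

End Trigo.

(** Applied to the vectors with a nonzero projection: these have the smallest
    angles, hence come first in a basis sorted by angle, and keep their indices
    when the other vectors are filtered out. *)
Lemma filter_sorted_take (T : eqType) (r : rel T) (P : pred T) (s : seq T) :
    transitive r -> {in s &, forall x y, r x y -> P y -> P x} -> sorted r s ->
  filter P s = take (count P s) s.
Proof.
move=> r_tr; elim: s => //= x s IHs rP; rewrite path_sortedE // => /andP[xs ss].
case: ifP => Px /=.
  by rewrite IHs // => y z ys zs; apply: rP; rewrite inE ?ys ?zs orbT.
have s0 : count P s = 0%N.
  apply/eqP; rewrite -leqn0 leqNgt -has_count; apply/negP => /hasP[y ys Py].
  by move: Px; rewrite (rP x y) ?mem_head ?inE ?ys ?orbT // (allP xs).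
by rewrite s0; apply: size0nil; rewrite size_filter s0.
Qed.

(** * Orthonormal families *)

(** Real and complex scalars are treated together: [iota] and [rho] carry the
    nonnegative scalars to [R] and back, so that square roots can be taken
    there, and the equation [mul_conj] stands for the conjugation of either
    field. *)
Section Orthonormal.
Variables (R : realType) (K : numFieldType).
Variables (iota : {rmorphism R -> K}) (rho : K -> R).
Variable conj : {rmorphism K -> K}.
Hypothesis mul_conj : forall x, x * conj x = `|x| ^+ 2.
Hypothesis iota_ge0 : forall r, (0 <= iota r) = (0 <= r).
Hypothesis rhoK : forall x, 0 <= x -> iota (rho x) = x.
Variables (X : vectType K) (form : {dot X for conj}).
Implicit Types (u v x : X) (s t : seq X) (V W : {vspace X}).

Local Notation "A ^H" := (map_mx conj A^T) (at level 2, format "A ^H").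

Lemma formC u v : form u v = conj (form v u).
Proof. by rewrite hermC expr0 mul1r. Qed.

Lemma form_eq0C u v : form u v = 0 -> form v u = 0.
Proof. by move=> uv; rewrite formC uv rmorph0. Qed.

Lemma formZr a u v : form u (a *: v) = conj a * form u v.
Proof. by rewrite linearZr_LR. Qed.

Lemma formZl a u v : form (a *: u) v = a * form u v.
Proof. by rewrite linearZl_LR. Qed.

Lemma formBr u v w : form u (v - w) = form u v - form u w.
Proof. by rewrite linearBr. Qed.

Lemma formBl u v w : form (u - v) w = form u w - form v w.
Proof. by rewrite linearBl. Qed.

Lemma form_ge0 u : 0 <= form u u.
Proof.
have [->|u0] := eqVneq u 0; first by rewrite linear0r.
by rewrite ltW // neq0_dnorm_gt0.
Qed.

Lemma form_eq0 u : form u u = 0 -> u = 0.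
Proof.
move=> uu; apply/eqP; apply: contraT => u0.
by have := neq0_dnorm_gt0 (s := form) _ u0; rewrite uu ltxx.
Qed.

Definition nrm u : R := Num.sqrt (rho (form u u)).

Lemma nrm_ge0 u : 0 <= nrm u. Proof. exact: sqrtr_ge0. Qed.

Lemma sqr_nrm u : iota (nrm u) ^+ 2 = form u u.
Proof.
rewrite -rmorphXn sqr_sqrtr /= ?rhoK ?form_ge0 //.
by rewrite -iota_ge0 rhoK form_ge0.
Qed.

Lemma conj_iota r : conj (iota r) = iota r.
Proof.
wlog r_ge0 : r / 0 <= r => [wlog_ge0|].
  have [/wlog_ge0//|r_lt0] := leP 0 r.
  by apply: oppr_inj; rewrite -!rmorphN wlog_ge0 // oppr_ge0 ltW.
by apply: (conj_ge0_id mul_conj); rewrite iota_ge0.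
Qed.

Lemma exists_unit V : V != 0%VS -> exists2 x, x \in V & form x x = 1.
Proof.
rewrite -vpick0 => v_neq0; set v := vpick V in v_neq0.
have nv : iota (nrm v) != 0.
  by rewrite -[_ == _]andTb -(expf_eq0 _ 2) sqr_nrm gt_eqF // neq0_dnorm_gt0.
exists ((iota (nrm v))^-1 *: v); first by rewrite memvZ // memv_pick.
by rewrite formZr formZl fmorphV conj_iota -sqr_nrm; field.
Qed.

(** Orthonormality phrased by membership, so that it is visibly stable under
    sorting and filtering; [orthonormalP] relates it to [orthonormal]. *)
Definition ons s := uniq s /\ {in s &, forall u v, form u v = (u == v)%:R}.

Lemma ons_cons x s : ons (x :: s) <->
  [/\ form x x = 1, {in s, forall v, form x v = 0} & ons s].
Proof.
split=> [[/= /andP[xs us] ons_s]|[xx xs [us ons_s]]].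
  split; first by rewrite ons_s ?mem_head ?eqxx.
    move=> v vs; rewrite ons_s ?mem_head ?inE ?vs ?orbT //.
    by case: eqP xs => // ->; rewrite vs.
  by split=> // u v us' vs; rewrite ons_s ?inE ?us' ?vs ?orbT.
split=> [/=|u v].
  by rewrite us andbT; apply/negP => /xs/eqP; rewrite xx oner_eq0.
have x_neq v' : v' \in s -> (x == v') = false.
  move=> vs; apply/negP => /eqP xv; move/eqP: (xs _ vs).
  by rewrite -xv xx oner_eq0.
rewrite !inE => /orP[/eqP->|u_s] /orP[/eqP->|v_s].
- by rewrite eqxx.
- by rewrite xs // x_neq.
- by rewrite form_eq0C ?xs // eq_sym x_neq.
- exact: ons_s.
Qed.

Lemma orthonormalP s : reflect (ons s) (orthonormal form s).
Proof.
apply: (iffP idP); elim: s => [|x s IHs] //.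
- rewrite /orthonormal /= => /andP[/andP[/eqP xx s1] /andP[]].
  rewrite andbT => /allP xs so; apply/ons_cons; split=> //.
    by move=> v /xs /eqP.
  by apply: IHs; rewrite /orthonormal s1.
move=> /ons_cons[xx xs /IHs]; rewrite /orthonormal /= xx eqxx andbT.
move=> /andP[-> ->]; rewrite !andbT /=.
by apply/allP => v /xs /= ->.
Qed.

Lemma mem_cap_orthov x V v :
  reflect (v \in V /\ form x v = 0) (v \in V :&: orthov form <[x]>)%VS.
Proof.
rewrite memv_cap mem_orthov1; apply: (iffP andP) => -[vV]; split=> //.
  by apply: form_eq0C; apply/eqP.
by apply/eqP; exact: form_eq0C.
Qed.

Lemma dim_cap_orthov x V : x \in V -> form x x = 1 ->
  (\dim (V :&: orthov form <[x]>)).+1 = \dim V.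
Proof.
move=> xV xx; rewrite -(eq_dim_orthov1 (u := x)).
  rewrite prednK // lt0n dimv_eq0; apply/eqP => V0.
  move/eqP: xx; rewrite (_ : x = 0) ?linear0r 1?eq_sym ?oner_eq0 //.
  by apply/eqP; rewrite -memv0 -V0.
have xx_neq0 : form x x != 0 by rewrite xx oner_eq0.
by apply/mem_orthovPn; exists x.
Qed.

(** Induction on the dimension, splitting off one unit vector [x] and passing to
    its orthogonal complement in [V]. *)
Lemma ons_extend s V : ons s -> {subset s <= V} ->
  exists t, [/\ ons (s ++ t), {subset t <= V} & size (s ++ t) = \dim V].
Proof.
have [n dimV] := ubnP (\dim V); elim: n s V dimV => // n IHn s V dimV.
have step x s' : x \in V -> ons (x :: s') -> {subset s' <= V} ->
    exists t, [/\ ons (x :: s' ++ t), {subset t <= V}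
      & (size (s' ++ t)).+1 = \dim V].
  move=> xV /ons_cons[xx xs' ons_s'] s'V.
  have [||t [ons_t tV' sizet]] := IHn s' (V :&: orthov form <[x]>)%VS _ ons_s'.
  - by rewrite dim_cap_orthov.
  - by move=> v vs'; apply/mem_cap_orthov; rewrite s'V ?xs'.
  exists t; split; last by rewrite sizet dim_cap_orthov.
    apply/ons_cons; split=> // v.
    by rewrite mem_cat => /orP[/xs' //|/tV'/mem_cap_orthov[]].
  by move=> v /tV'/mem_cap_orthov[].
case: s => [_ _|x s' ons_s s'V]; last first.
  by apply: step => // [|v vs']; apply: s'V; rewrite inE ?eqxx ?vs' ?orbT.
have [V0|/exists_unit[x xV xx]] := eqVneq V 0%VS.
  by exists [::]; split; rewrite ?V0 ?dimv0.
have [||t [ons_t tV sizet]] := step x [::] xV => //.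
  by apply/ons_cons; split.
by exists (x :: t); split=> // v; rewrite inE => /orP[/eqP->|/tV].
Qed.

Definition proj s u := \sum_(x <- s) form u x *: x.

Lemma form_proj s u v : ons s -> v \in s -> form (proj s u) v = form u v.
Proof.
move=> [us ons_s] vs; rewrite linear_sumlz (bigD1_seq v) //= formZl.
rewrite (ons_s v v) // eqxx mulr1 big_seq_cond big1 ?addr0 // => x /andP[xs xv].
by rewrite formZl (ons_s x v) // (negPf xv) mulr0.
Qed.

Lemma proj_span s u : proj s u \in <<s>>%VS.
Proof.
by rewrite /proj big_seq; apply: memv_suml => x xs; rewrite memvZ // memv_span.
Qed.

Lemma proj_id s u : ons s -> u \in <<s>>%VS -> proj s u = u.
Proof.
move=> ons_s us; apply/eqP; rewrite -subr_eq0; apply/eqP/form_eq0.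
set w := proj s u - u.
have ws : w \in <<s>>%VS by rewrite memvB // proj_span.
have : orthogonal form [:: w] s.
  apply/orthogonalP => w' x; rewrite inE => /eqP-> xs.
  by rewrite linearBl /= form_proj // subrr.
rewrite orthogonalE => /orthovP; apply=> //.
by rewrite memv_span ?mem_head.
Qed.

Lemma ons_basis s V :
  ons s -> {subset s <= V} -> size s = \dim V -> basis_of V s.
Proof.
move=> ons_s sV sizes; rewrite basisEdim -sizes leqnn andbT.
have sub : (<<s>> <= V)%VS by apply/span_subvP.
suff fs : free s.
  by have /eqP -> : <<s>>%VS == V by rewrite eqEdim sub -sizes (eqP fs) leqnn.
case: ons_s => us ons_s.
rewrite -[s]in_tupleE; apply/freeP => k sum0 i.
have := congr1 (fun u => form u s`_i) sum0; rewrite linear0l linear_sumlz.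
rewrite (bigD1 i) //= formZl ons_s ?mem_nth // eqxx mulr1 big1 ?addr0 //.
move=> j ji; rewrite formZl ons_s ?mem_nth // nth_uniq //.
by rewrite (inj_eq val_inj) (negPf ji) mulr0.
Qed.

Lemma proj_is_linear s : linear (proj s).
Proof.
move=> a u v; rewrite /proj scaler_sumr -big_split /=; apply: eq_bigr => x _.
by rewrite linearDl /= formZl scalerDl scalerA.
Qed.

HB.instance Definition _ s :=
  GRing.isLinear.Build K X X *:%R (proj s) (proj_is_linear s).

Lemma proj_adjoint s u v : form (proj s u) v = form u (proj s v).
Proof.
rewrite linear_sumlz linear_sumr /=; apply: eq_bigr => x _.
by rewrite formZl formZr -formC mulrC.
Qed.

Lemma nrm_proj_le1 s u : ons s -> form u u = 1 -> nrm (proj s u) <= 1.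
Proof.
move=> ons_s uu.
have pp : form (proj s u) (proj s u) = form u (proj s u).
  by rewrite proj_adjoint (proj_id (u := proj s u)) ?proj_span.
have : 0 <= form (u - proj s u) (u - proj s u) by exact: form_ge0.
rewrite formBl !formBr uu [form _ u]proj_adjoint -!pp subrr subr0.
rewrite -sqr_nrm -(rmorph1 iota) -rmorphXn -rmorphB iota_ge0 subr_ge0.
by rewrite expr_le1 // nrm_ge0.
Qed.

(** * Existence of principal angles *)

(** For the complex numbers this holds because they are algebraically closed;
    for the reals it is [hermitian_eigen_real]. *)
Hypothesis hermitian_eigen : forall n (M : 'M[K]_n.+1), M^H = M ->
  exists l, exists2 u : 'rV_n.+1, u != 0 & u *m M = l *: u.

(** An eigenvector [y] of the matrix of the form [<T u, T v>] in an orthonormal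
    basis of [V] satisfies [<T y, T v> = l <y, v>] on [V], so that orthogonality
    to [y] is inherited by the images under [T]. *)
Lemma exists_critical (T : {linear X -> X}) V : V != 0%VS ->
  exists x, [/\ x \in V, form x x = 1 &
    {in V, forall v, form x v = 0 -> form (T x) (T v) = 0}].
Proof.
move=> V_neq0.
have [||b [ons_b bV sizeb]] := @ons_extend [::] V; [by []|by []|].
rewrite /= in ons_b sizeb.
have spanb := span_basis (ons_basis ons_b bV sizeb).
have [n dimV] : exists n, \dim V = n.+1.
  by exists (\dim V).-1; rewrite prednK // lt0n dimv_eq0.
rewrite dimV in sizeb.
pose M := \matrix_(i < n.+1, j < n.+1) form (T b`_i) (T b`_j).
have [|l [u u_neq0 uM]] := hermitian_eigen (M := M).
  by apply/matrixP => i j; rewrite !mxE -formC.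
pose y := \sum_i u 0 i *: b`_i.
have yb (j : 'I_n.+1) : form y b`_j = u 0 j.
  rewrite linear_sumlz (bigD1 j) //= formZl ons_b.2 ?mem_nth ?sizeb //.
  rewrite eqxx mulr1.
  rewrite big1 ?addr0 // => i ij.
  rewrite formZl ons_b.2 ?mem_nth ?sizeb // nth_uniq ?sizeb ?ons_b.1 //.
  by rewrite (inj_eq val_inj) (negPf ij) mulr0.
have yV : y \in V.
  by apply: memv_suml => i _; rewrite memvZ // bV // mem_nth ?sizeb.
have y_neq0 : y != 0.
  apply: contraNneq u_neq0 => y0; apply/eqP/rowP => j.
  by rewrite -yb y0 linear0l mxE.
have crit v : v \in V -> form (T y) (T v) = l * form y v.
  rewrite -spanb => vb.
  rewrite -(proj_id ons_b vb) /proj (big_nth 0) sizeb big_mkord.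
  rewrite !linear_sum /= mulr_sumr; apply: eq_bigr => j _.
  rewrite [T _]linearZ /= !formZr yb mulrCA; congr (_ * _).
  have := congr1 (fun w : 'rV_n.+1 => w 0 j) uM; rewrite !mxE => <-.
  rewrite linear_sumlz; apply: eq_bigr => i _.
  by rewrite [T _]linearZ /= formZl mxE.
have [|x /vlineP[k ->] xx] := @exists_unit <[y]>%VS.
  by rewrite -dimv_eq0 dim_vline y_neq0.
exists (k *: y); split=> //; first by rewrite memvZ.
move=> v vV; rewrite linearZ /= !formZl crit // => /eqP.
by rewrite mulrCA => /eqP ->; rewrite mulr0.
Qed.

Lemma exists_diagonal_ons (T : {linear X -> X}) V :
  exists s, [/\ ons s, {subset s <= V}, size s = \dim V &
    {in s &, forall u v, u != v -> form (T u) (T v) = 0}].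
Proof.
have [n dimV] := ubnP (\dim V); elim: n V dimV => // n IHn V dimV.
have [V0|/(exists_critical T)[x [xV xx x_crit]]] := eqVneq V 0%VS.
  by exists [::]; split; rewrite ?V0 ?dimv0.
have [|s [ons_s sV' sizes s_diag]] := IHn (V :&: orthov form <[x]>)%VS.
  by rewrite dim_cap_orthov.
have sV v : v \in s -> v \in V by move/sV'/mem_cap_orthov => [].
have xs v : v \in s -> form x v = 0 by move/sV'/mem_cap_orthov => [].
exists (x :: s); split.
- exact/ons_cons.
- by move=> v; rewrite inE => /orP[/eqP->|/sV].
- by rewrite /= sizes dim_cap_orthov.
have xTs v : v \in s -> form (T x) (T v) = 0.
  by move=> vs; apply: x_crit; [exact: sV|exact: xs].
move=> u v; rewrite !inE => /orP[/eqP->|us] /orP[/eqP->|vs].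
- by rewrite eqxx.
- by move=> _; exact: xTs.
- by move=> _; apply/form_eq0C/xTs.
- exact: s_diag.
Qed.

Lemma ler_iota a b : (iota a <= iota b) = (a <= b).
Proof. by rewrite -subr_ge0 -rmorphB iota_ge0 subr_ge0. Qed.

(** The basis [s] of [V] makes the projections [P u] on [W] pairwise orthogonal,
    and the angle of [u] has cosine [nrm (P u)]. The basis of [W] starts with
    the normalized nonzero projections [pre]; the vectors that complete it are
    orthogonal to the projection of [V], so that all their inner products with
    [s] vanish, as they should. *)
Lemma exists_principal_angles V W : (\dim V <= \dim W)%N ->
  exists a, @is_principal_angles R K iota conj X form V W a.
Proof.
move=> dimVW.
have [||b [ons_b bW sizeb]] := @ons_extend [::] W; [by []|by []|].
rewrite /= in ons_b sizeb.
have spanb := span_basis (ons_basis ons_b bW sizeb).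
pose P := proj b.
have PW u : P u \in W by rewrite -spanb proj_span.
have P_id w : w \in W -> P w = w by rewrite -spanb; exact: proj_id.
have [s0 [ons_s0 s0V sizes0 s0_diag]] := exists_diagonal_ons P V.
pose theta u := acos (nrm (P u)).
pose r := [rel u v | theta u <= theta v].
have r_total : total r by move=> u v; exact: le_total.
have r_trans : transitive r by move=> u v w; exact: le_trans.
pose s := sort r s0.
have mem_s u : (u \in s) = (u \in s0) by rewrite mem_sort.
have sizes : size s = \dim V by rewrite size_sort.
have ons_s : ons s.
  split; first by rewrite sort_uniq ons_s0.1.
  by move=> u v; rewrite !mem_s; exact: ons_s0.2.
have sV u : u \in s -> u \in V by rewrite mem_s => /s0V.
have s_diag u v : u \in s -> v \in s ->
    form (P u) (P v) = if u == v then iota (nrm (P u)) ^+ 2 else 0.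
  move=> us vs; case: eqVneq => [<-|uv]; first by rewrite sqr_nrm.
  by apply: s0_diag; rewrite -?mem_s.
have nrm01 u : u \in s -> 0 <= nrm (P u) <= 1.
  by move=> us; rewrite nrm_ge0 nrm_proj_le1 // ons_s.2 // eqxx.
have cos_theta u : u \in s -> cos (theta u) = nrm (P u).
  move=> /nrm01/andP[n0 n1]; rewrite acosK // in_itv /= n1 andbT.
  by rewrite (le_trans _ n0) // lerN10.
pose nz u := nrm (P u) != 0.
pose c u : K := (iota (nrm (P u)))^-1.
have c_neq0 u : nz u -> iota (nrm (P u)) != 0 by rewrite fmorph_eq0.
pose pre := [seq c u *: P u | u <- filter nz s].
have pre_W u : u \in pre -> u \in W by move=> /mapP[v _ ->]; rewrite memvZ.
have form_c u v : u \in s -> v \in s -> nz u -> nz v ->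
    form (c u *: P u) (c v *: P v) = (u == v)%:R.
  move=> us vs nu nv; rewrite formZr formZl s_diag // /c fmorphV conj_iota.
  case: eqVneq => [<-|_]; last by rewrite !mulr0.
  by have cu := c_neq0 _ nu; rewrite /=; field.
have ons_pre : ons pre.
  split=> [|_ _ /mapP[u fu ->] /mapP[v fv ->]].
    rewrite map_inj_in_uniq ?filter_uniq ?ons_s.1 // => u v.
    rewrite !mem_filter => /andP[nu us] /andP[nv vs] eq_uv.
    have := form_c u v us vs nu nv; rewrite eq_uv form_c // eqxx.
    by case: eqVneq => // _ /eqP; rewrite oner_eq0.
  move: fu fv; rewrite !mem_filter => /andP[nu us] /andP[nv vs].
  rewrite form_c //.
  congr (_%:R); case: eqVneq => [->|uv]; first by rewrite eqxx.
  case: eqVneq => // eq_uv; have := form_c u v us vs nu nv.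
  by rewrite eq_uv form_c // eqxx (negPf uv) => /eqP; rewrite oner_eq0.
have [t [ons_f tW sizef]] := ons_extend ons_pre pre_W.
set f := pre ++ t in ons_f sizef.
have fW u : u \in f -> u \in W by rewrite mem_cat => /orP[/pre_W|/tW].
pose k := count nz s.
have filter_s : filter nz s = take k s.
  apply: (filter_sorted_take r_trans); last exact: sort_sorted.
  move=> u v us vs /= uv nv; apply/negP => /eqP nu0.
  have [/andP[u0 u1] /andP[v0 v1]] := (nrm01 _ us, nrm01 _ vs).
  have theta_itv w : w \in s -> theta w \in `[0, pi].
    move=> ws; have /acos_itv01/andP[w0 wp] := nrm01 _ ws.
    by rewrite in_itv /= w0 (le_trans wp) // ; have := pi_gt0 R; lra.
  move: uv; rewrite leNgt -ltr_cos ?theta_itv // !cos_theta // nu0.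
  move=> /negP; apply.
  by rewrite lt_neqAle eq_sym v0 andbT; exact: nv.
have k_le : (k <= \dim V)%N by rewrite -sizes count_size.
have size_pre : size pre = k by rewrite size_map size_filter.
have size_t : size [seq theta u | u <- s] == minn (\dim V) (\dim W).
  by rewrite size_map sizes (minn_idPl dimVW).
have size_e : size s == \dim V by rewrite sizes.
have size_f : size f == \dim W by rewrite sizef.
exists (Tuple size_t), (Tuple size_e), (Tuple size_f); split.
- rewrite /= ons_basis //=; exact/orthonormalP.
- rewrite /= ons_basis //=; exact/orthonormalP.
- rewrite /= sorted_map; exact: sort_sorted.
- by move=> _ /mapP[u us ->]; apply/acos_itv01/nrm01.
move=> i j; rewrite !(tnth_nth 0) /inner /=.
have is_lt : (i < size s)%N by rewrite sizes.
have us : s`_i \in s by rewrite mem_nth.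
rewrite (nth_map 0) // cos_theta //.
have jW : f`_j \in W by rewrite fW // mem_nth ?sizef.
(* As [f`_j] lies in [W], only the projection of [s`_i] matters. *)
rewrite -[f`_j]P_id // {1}/P proj_adjoint -/(P _).
have [jk|kj] := ltnP j k.
  have js : (j < size s)%N by rewrite sizes (leq_trans jk).
  have vs : s`_j \in s by rewrite mem_nth.
  have nv : nz s`_j.
    have : s`_j \in filter nz s.
      rewrite filter_s -(nth_take 0 jk) mem_nth //.
      by rewrite size_take_min (minn_idPl _) // sizes.
    by rewrite mem_filter => /andP[].
  rewrite nth_cat size_pre jk (nth_map 0) ?size_filter // filter_s nth_take //.
  rewrite formZl s_diag // nth_uniq ?ons_s.1 // eq_sym.
  case: eqP => [->|_]; last by rewrite mulr0.
  by have := c_neq0 _ nv; rewrite /c => ?; field.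
rewrite nth_cat size_pre ltnNge kj /=.
have vt : t`_(j - k) \in t.
  rewrite mem_nth // -(ltn_add2l k) subnKC // -[in X in (_ < X)%N]size_pre.
  by rewrite -size_cat sizef.
have [nu|nu] := boolP (nz s`_i).
  have u_filter : s`_i \in filter nz s by rewrite mem_filter nu us.
  have ik : (i < k)%N.
    move: u_filter; rewrite filter_s => /(nthP 0)[m].
    rewrite size_take_min (minn_idPl _) ?sizes // => mk.
    rewrite nth_take // => /eqP.
    rewrite nth_uniq ?ons_s.1 ?sizes ?(leq_trans mk) //.
    by move=> /eqP <-.
  rewrite ltn_eqF ?(leq_trans ik) //.
  have pre_u : c s`_i *: P s`_i \in pre by apply/mapP; exists s`_i.
  have : form t`_(j - k) (c s`_i *: P s`_i) = 0.
    rewrite ons_f.2 ?mem_cat ?vt ?pre_u ?orbT //.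
    case: eqVneq => // eq_t; have := ons_f.1; rewrite cat_uniq.
    by move=> /and3P[_ /hasPn/(_ _ vt)/=]; rewrite eq_t pre_u.
  rewrite formZr => /eqP; rewrite mulf_eq0 fmorph_eq0 invr_eq0.
  by rewrite (negPf (c_neq0 _ nu)) => /eqP.
move: nu; rewrite negbK => /eqP nu0.
rewrite nu0 rmorph0 if_same (_ : P s`_i = 0) ?linear0r //.
by apply: form_eq0; rewrite -sqr_nrm nu0 rmorph0 expr0n.
Qed.

(** * The Grassmann angle as a Gram determinant *)

Definition gram p q (e : p.-tuple X) (f : q.-tuple X) : 'M[K]_(p, q) :=
  \matrix_(i, j) form (tnth e i) (tnth f j).

Lemma gram_adj p q (e : p.-tuple X) (f : q.-tuple X) : (gram e f)^H = gram f e.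
Proof. by apply/matrixP => i j; rewrite !mxE -formC. Qed.

Lemma gram_ons p (e : p.-tuple X) : ons e -> gram e e = 1%:M.
Proof.
move=> [ue ons_e]; apply/matrixP => i j; rewrite !mxE !(tnth_nth 0).
by rewrite ons_e ?mem_nth ?size_tuple // nth_uniq ?size_tuple.
Qed.

(** Parseval's identity: an orthonormal family [b] can be inserted in a Gram
    matrix as soon as it spans one of the two sides. *)
Lemma gram_mul p q n (e : p.-tuple X) (f : q.-tuple X) (b : n.-tuple X) :
    ons b -> {subset e <= <<b>>%VS} -> gram e b *m gram b f = gram e f.
Proof.
move=> ons_b eb; apply/matrixP => i j; rewrite !mxE.
rewrite -[in RHS](proj_id ons_b (eb _ (mem_tnth i e))) linear_sumlz big_tuple /=.
by apply: eq_bigr => k _; rewrite !mxE formZl.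
Qed.

Lemma gram_mulr p q n (e : p.-tuple X) (f : q.-tuple X) (b : n.-tuple X) :
    ons b -> {subset f <= <<b>>%VS} -> gram e b *m gram b f = gram e f.
Proof.
move=> ons_b fb; rewrite -(gram_adj f e) -(gram_mul e ons_b fb).
by rewrite trmx_mul map_mxM !gram_adj.
Qed.

Lemma basis_sub_span r (s s' : r.-tuple X) V :
  basis_of V s -> basis_of V s' -> {subset s <= <<s'>>%VS}.
Proof.
move=> sV s'V u us; rewrite (span_basis s'V) -(span_basis sV).
exact: memv_span.
Qed.

(** A change of the orthonormal basis of [W] leaves the matrix unchanged, as it
    depends only on the projection on [W]; a change of basis of [V] conjugates
    it by a unitary matrix. *)
Lemma det_gram_basis p q V W (e e' : p.-tuple X) (f f' : q.-tuple X) :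
    ons e -> basis_of V e -> ons e' -> basis_of V e' ->
    ons f -> basis_of W f -> ons f' -> basis_of W f' ->
  \det (gram e' f' *m (gram e' f')^H) = \det (gram e f *m (gram e f)^H).
Proof.
move=> oe eV oe' e'V of_ fW of' f'W.
have -> : gram e' f' *m (gram e' f')^H = gram e' f *m (gram e' f)^H.
  rewrite !gram_adj -(gram_mul e' of_ (basis_sub_span f'W fW)) mulmxA.
  by rewrite gram_mulr //; exact: basis_sub_span fW f'W.
rewrite -(gram_mul f oe (basis_sub_span e'V eV)) trmx_mul map_mxM.
rewrite mulmxA -(mulmxA (gram e' e)) !det_mulmx mulrAC -det_mulmx !gram_adj.
by rewrite (gram_mul e' oe (basis_sub_span e'V eV)) gram_ons // det1 mul1r.
Qed.

Lemma principal_anglesP V W : (\dim V <= \dim W)%N ->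
  is_principal_angles iota form (principal_angles iota form V W).
Proof. by move=> /exists_principal_angles; exact: classical_sets.xgetPex. Qed.

(** In principal bases the matrix [gram e f *m (gram e f)^H] is diagonal, with
    the squared cosines of the principal angles as entries. *)
Lemma grassmann_angle_gram V W : V != 0%VS -> (\dim V <= \dim W)%N ->
  exists (c : R) (d : 'rV[K]_(\dim V)) (e : (\dim V).-tuple X)
         (f : (\dim W).-tuple X),
    [/\ 0 <= c <= 1, grassmann_angle iota form V W = acos c,
        [/\ ons e, basis_of V e, ons f & basis_of W f],
        gram e f *m (gram e f)^H = diag_mx d /\ (forall i, 0 <= d 0 i <= 1)
      & \det (gram e f *m (gram e f)^H) = iota (c ^+ 2)].
Proof.
move=> V_neq0 dimVW; have dimV_gt0 : (0 < \dim V)%N by rewrite lt0n dimv_eq0.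
have W_neq0 : W != 0%VS by rewrite -dimv_eq0 -lt0n (leq_trans dimV_gt0).
rewrite /grassmann_angle (negPf V_neq0) (negPf W_neq0) dimVW.
have [e [f [/andP[eV oe] /andP[fW of_] _ a01 ef]]] := principal_anglesP dimVW.
set a := principal_angles iota form V W in a01 ef *.
move/orthonormalP in oe; move/orthonormalP in of_.
have size_a : size a = \dim V by rewrite size_tuple (minn_idPl dimVW).
have cos_a01 i : (i < \dim V)%N -> 0 <= cos a`_i <= 1.
  move=> iV; have /a01/andP[a0 api] : a`_i \in a by rewrite mem_nth ?size_a.
  rewrite cos_le1 andbT cos_ge0_pihalf // api andbT (le_trans _ a0) //.
  by rewrite oppr_le0 divr_ge0 ?pi_ge0.
have ef_entry i j : gram e f i j = if i == j :> nat then iota (cos a`_i) else 0.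
  rewrite mxE formC; have := ef i j; rewrite /inner => ->.
  by case: eqP; rewrite ?conj_iota ?rmorph0.
pose d : 'rV[K]_(\dim V) := \row_i iota (cos a`_i ^+ 2).
have diag : gram e f *m (gram e f)^H = diag_mx d.
  apply/matrixP => i i'; rewrite !mxE.
  pose j := widen_ord dimVW i.
  rewrite (bigD1 j) //= big1 ?addr0 => [|k kj].
    rewrite [X in _ * X]mxE [X in conj X]mxE !ef_entry /= eqxx.
    case: (eqVneq i' i) => [->|i'i].
      by rewrite !eqxx mulr1n conj_iota rmorphXn expr2.
    by rewrite (inj_eq val_inj) (negPf i'i) rmorph0 mulr0.
  rewrite ef_entry ifF ?mul0r //; apply: contra_neqF kj => /eqP ik.
  by apply: val_inj.
exists (\prod_(x <- a) cos x), d, e, f.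
have prod_a : \prod_(x <- a) cos x = \prod_(i < \dim V) cos a`_i.
  by rewrite (big_nth 0) size_a big_mkord.
split=> //.
- rewrite prod_a; apply/andP; split.
    by apply: prodr_ge0 => i _; have /andP[] := cos_a01 i (ltn_ord i).
  by apply: prodr_ile1 => i _; exact: cos_a01.
- split=> // i; rewrite mxE -(rmorph0 iota) -(rmorph1 iota) !ler_iota sqr_ge0.
  by have /andP[c0 c1] := cos_a01 i (ltn_ord i); rewrite expr_le1.
rewrite diag det_diag prod_a -prodrXl rmorph_prod.
by apply: eq_bigr => i _; rewrite mxE.
Qed.

Lemma grassmann_angle_itv V W : 0 <= grassmann_angle iota form V W <= pi / 2.
Proof.
have pi2 : 0 <= (pi : R) / 2 by rewrite divr_ge0 ?pi_ge0.
have [V0|V_neq0] := eqVneq V 0%VS.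
  by rewrite /grassmann_angle V0 eqxx lexx.
have [dimVW|dimVW] := leqP (\dim V) (\dim W).
  have [c [d [e [f [c01 -> _ _ _]]]]] := grassmann_angle_gram V_neq0 dimVW.
  exact: acos_itv01.
rewrite /grassmann_angle (negPf V_neq0) leqNgt dimVW /=.
by case: ifP; rewrite pi2 lexx.
Qed.

(** * The triangle inequality *)

(** The bases [f] and [g] are principal for [V] and [W], which makes
    [B *m B^H] diagonal in [blade_triangle]; the other two angles are computed
    in the bases [e], [f], [g] thanks to [det_gram_basis]. *)
Theorem grassmann_angle_triangle U V W :
  grassmann_angle iota form U W
    <= grassmann_angle iota form U V + grassmann_angle iota form V W.
Proof.
have /andP[UV0 UVp] := grassmann_angle_itv U V.
have /andP[VW0 VWp] := grassmann_angle_itv V W.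
have /andP[UW0 UWp] := grassmann_angle_itv U W.
have [U0|U_neq0] := eqVneq U 0%VS.
  by rewrite {1}/grassmann_angle U0 eqxx addr_ge0 //; rewrite -U0.
have right_angle Y Z :
    (\dim Z < \dim Y)%N -> grassmann_angle iota form Y Z = pi / 2.
  move=> dimZY; rewrite /grassmann_angle leqNgt dimZY.
  rewrite ifF; first by case: ifP.
  by apply: contraTF dimZY => /eqP ->; rewrite dimv0.
have [dimUV|dimUV] := leqP (\dim U) (\dim V); last first.
  by rewrite (right_angle U V) // (le_trans UWp) // lerDl.
have [dimVW|dimVW] := leqP (\dim V) (\dim W); last first.
  by rewrite (right_angle V W) // (le_trans UWp) // lerDr.
have V_neq0 : V != 0%VS.
  by rewrite -dimv_eq0 -lt0n (leq_trans _ dimUV) // lt0n dimv_eq0.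
have [x [_ [e [f' [x01 angUV [oe eU of' f'V] _ detUV]]]]] :=
  grassmann_angle_gram U_neq0 dimUV.
have [y [d [f [g [y01 angVW [of_ fV og gW] [diagVW d01] detVW]]]]] :=
  grassmann_angle_gram V_neq0 dimVW.
have [z [_ [e' [g' [z01 angUW [oe' e'U og' g'W] _ detUW]]]]] :=
  grassmann_angle_gram U_neq0 (leq_trans dimUV dimVW).
rewrite angUV angVW angUW; apply: acos_triangle => //.
have {}detUV := etrans (det_gram_basis oe eU oe eU of' f'V of_ fV) detUV.
have {}detUW := etrans (det_gram_basis oe' e'U oe eU og' g'W og gW) detUW.
move: (x01) (y01) (z01) => /andP[x0 x1] /andP[y0 y1] /andP[z0 z1].
have [x_eq0|x_neq0] := eqVneq x 0.
  by rewrite x_eq0 mul0r addr_ge0 // mulr_ge0 ?sqrtr_ge0.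
have x_gt0 : 0 < x by rewrite lt_neqAle eq_sym x_neq0.
have [||b0 [ob _ sizeb]] := @ons_extend [::] {:X}%VS; [by []|by []|].
rewrite /= in ob sizeb.
pose b := in_tuple b0.
have spanb r (s : r.-tuple X) : {subset s <= <<b>>%VS}.
  move=> u _; rewrite (span_basis (ons_basis ob _ sizeb)) ?memvf // => v _.
  exact: memvf.
have gramE r r' (s : r.-tuple X) (s' : r'.-tuple X) :
    gram s b *m (gram s' b)^H = gram s s' by rewrite gram_adj gram_mul.
have := @blade_triangle K conj mul_conj _ _ _ _
  (gram e b) (gram f b) (gram g b) d.
rewrite /= !gramE !gram_ons // detUV detVW detUW.
move=> /(_ erefl erefl erefl diagVW d01).
rewrite -(rmorph0 iota) lt_neqAle ler_iota sqr_ge0 andbT.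
rewrite (inj_eq (fmorph_inj iota)) eq_sym expf_eq0 /= x_neq0 => /(_ isT).
move=> [w [/andP[w_ge w_le] [k [k_le m_le]]]].
have w0 : 0 <= w.
  by apply: le_trans w_ge; rewrite -rmorphM iota_ge0 mulr_ge0 ?sqr_ge0.
apply: (@cos_triangle_of_square R x y z
  (rho w) (rho `|k|) (rho `|k - w|)) => //.
- by rewrite -iota_ge0 rhoK.
- by rewrite -!ler_iota rhoK // exprMn rmorphM /= w_ge.
- by rewrite -ler_iota rmorphXn rmorphM /= !rhoK.
- rewrite -ler_iota rmorphD /= !rhoK //.
  by have := ler_normB k (k - w); rewrite subKr (ger0_norm w0).
- rewrite -ler_iota rmorphXn rmorphM !rmorphB rmorph1 fmorph_div /= !rhoK //.
  by rewrite (rmorphXn _ 2 (rho w)) /= rhoK.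
Qed.
End Orthonormal.

(** * Real and complex scalars *)

Lemma exists_eigenvector_complex (R : realType) n (M : 'M[R[i]]_n.+1) :
  exists l, exists2 u : 'rV_n.+1, u != 0 & u *m M = l *: u.
Proof.
have [l /eigenvalueP[u uM u_neq0]] := eigenvalue_closed M (ltn0Sn n).
by exists l, u.
Qed.

(** Over the complex numbers a real symmetric matrix has a real eigenvalue; it
    is a real root of the characteristic polynomial, hence an eigenvalue over
    the reals as well. *)
Lemma hermitian_eigen_real (R : realType) n (M : 'M[R]_n.+1) : M^T = M ->
  exists l, exists2 u : 'rV_n.+1, u != 0 & u *m M = l *: u.
Proof.
move=> MT; pose toC : {rmorphism R -> R[i]} := real_complex R.
have herm : map_mx toC M \is hermsymmx.
  apply: realsym_hermsym.
    apply/is_hermitianmxP; rewrite expr0 scale1r map_mx_id //.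
    by rewrite map_trmx MT.
  by apply/mxOverP => i j; rewrite mxE; apply/complex_realP; exists (M i j).
have /orthomx_spectralP M_eq := hermitian_normalmx herm.
set P := spectralmx _ in M_eq; set d := spectral_diag _ in M_eq.
have P_unit : P \in unitmx by exact: spectral_unit.
have /complex_realP[l d0] : d 0 0 \is Num.real.
  by have /mxOverP := hermitian_spectral_diag_real herm; apply.
have : root (char_poly M) l.
  rewrite -(fmorph_root toC) map_char_poly -eigenvalue_root_char.
  apply/eigenvalueP; exists (row 0 P).
    rewrite M_eq -row_mul !mulmxA mulmxV // mul1mx row_mul row_diag_mx.
    by rewrite -scalemxAl -rowE d0.
  apply: contraTneq P_unit => P0; rewrite unitmxE (expand_det_row _ 0).
  rewrite big1 ?unitr0 // => j _.
  by have /rowP/(_ j) := P0; rewrite !mxE => ->; rewrite mul0r.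
by rewrite -eigenvalue_root_char => /eigenvalueP[u uM u_neq0]; exists l, u.
Qed.

Theorem theorem4p1 (R : realType) :
  (forall (X : vectType R) (form : {dot X for idfun}) (U V W : {vspace X}),
     real_grassmann_angle form U W <=
       real_grassmann_angle form U V + real_grassmann_angle form V W) /\
  (forall (X : vectType R[i]) (form : {dot X for Num.conj})
     (U V W : {vspace X}),
     complex_grassmann_angle form U W <=
       complex_grassmann_angle form U V + complex_grassmann_angle form V W).
Proof.
split=> X form U V W.
  apply: (@grassmann_angle_triangle R R idfun idfun idfun).
  - by move=> x /=; rewrite real_normK ?num_real // expr2.
  - by [].
  - by [].
  - move=> n M; rewrite map_mx_id //; exact: hermitian_eigen_real.
apply: (@grassmann_angle_triangle R R[i] (real_complex R) (@complex.Re R)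
  Num.conj).
- by move=> x; rewrite normCK.
- by move=> r; rewrite lecR.
- by move=> x x0; exact: RRe_real (ger0_real x0).
- by move=> n M _; exact: exists_eigenvector_complex.
Qed.
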